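(* Let $R$ be a Dedekind domain with fraction field $K$, let $R[x]=R[x_1,\dots,x_n]$ be equipped with a monomial ordering $<$, and let $G=\{(g_i,\mathfrak g_i)\mid 1\le i\le l\}$ be a finite set of non-zero pseudo-polynomials of $R[x]$. Then $G$ is a pseudo-Gröbner basis of $\langle G\rangle$ if and only if for all $1\le i<j\le l$ the S-polynomial $\operatorname{spoly}((g_i,\mathfrak g_i),(g_j,\mathfrak g_j))$ reduces to $0$ modulo $G$.
   Context: A Dedekind domain is a Noetherian integrally closed domain of Krull dimension one. A monomial ordering is a total well-ordering on monomials compatible with multiplication. For non-zero $f=\sum_\alpha c_\alpha x^\alpha\in K[x]$, $\deg(f)\in\mathbb N^n$ is the largest exponent $\alpha$ (with respect to $<$) with $c_\alpha\ne0$; $\operatorname{lm}(f)=x^{\deg(f)}$, $\operatorname{lc}(f)=c_{\deg(f)}$, $\operatorname{lt}(f)=\operatorname{lc}(f)\operatorname{lm}(f)$. A fractional ideal of $R$ is a non-zero finitely generated $R$-submodule of $K$; for a fractional ideal $\mathfrak a$, $\mathfrak a[x]$ is the set of polynomials in $K[x]$ with all coefficients in $\mathfrak a$. A pseudo-polynomial of $R[x]$ is a pair $(f,\mathfrak f)$ with $f\in K[x]$ and $\mathfrak f$ a fractional ideal of $R$ such that $\mathfrak f f\subseteq R[x]$; it is zero if $f=0$. Put $\operatorname{lc}(f,\mathfrak f)=\mathfrak f\operatorname{lc}(f)$ and $\langle(f,\mathfrak f)\rangle=\mathfrak f[x]f$; $\langle G\rangle=\sum_{i=1}^l\mathfrak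 g_i[x]g_i$. Reduction: let $(f,\mathfrak f)$ be a non-zero pseudo-polynomial and $J=\{i\mid \operatorname{lm}(g_i)\text{ divides }\operatorname{lm}(f)\}$. It can be reduced modulo $G$ if $\operatorname{lc}(f,\mathfrak f)\subseteq\sum_{i\in J}\operatorname{lc}(g_i,\mathfrak g_i)$; equivalently, there exist $a_i\in\mathfrak g_i\mathfrak f^{-1}$, $i\in J$, with $\operatorname{lc}(f)=\sum_{i\in J}a_i\operatorname{lc}(g_i)$. For any such choice, $(f-\sum_{i\in J}a_ix^{\deg(f)-\deg(g_i)}g_i,\ \mathfrak f)$ is called a one step reduction of $(f,\mathfrak f)$ with respect to $G$. We say that $(f,\mathfrak f)$ reduces to $(h,\mathfrak f)$ modulo $G$ if $(h,\mathfrak f)$ is obtained from $(f,\mathfrak f)$ by a finite (possibly empty) chain of one step reductions; ''reduces to $0$'' means reduces to $(0,\mathfrak f)$. Pseudo-Gröbner basis: $\operatorname{Lt}(g,\mathfrak g)=\mathfrak g[x]\operatorname{lt}(g)$, $\operatorname{Lt}(G)=\sum_i\operatorname{Lt}(g_i,\mathfrak g_i)$, and for an ideal $I$ of $R[x]$, $\operatorname{Lt}(I)$ is the ideal generated by the leading terms of the non-zero elements of $I$. A finite set $G$ of non-zero pseudo-polynomials with $\langle G\rangle\subseteq I$ is a pseudo-Gröbner basis of $I$ if $\operatorname{Lt}(I)=\operatorname{Lt}(G)$. S-polynomial: for non-zero pseudo-polynomials $(f,\mathfrak f)$, $(g,\mathfrak g)$ and $m=\operatorname{lcm}(\operatorname{lm}(f),\operatorname{lm}(g))$,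 $$\operatorname{spoly}((f,\mathfrak f),(g,\mathfrak g))=\Bigl(\tfrac{m}{\operatorname{lm}(f)}\tfrac1{\operatorname{lc}(f)}f-\tfrac{m}{\operatorname{lm}(g)}\tfrac1{\operatorname{lc}(g)}g,\ \operatorname{lc}(f)\mathfrak f\cap\operatorname{lc}(g)\mathfrak g\Bigr).$$ *)

(* Defs.v *)
From HB Require Import structures.
From Stdlib Require Export Relation_Operators.
From mathcomp Require Export all_boot all_order all_algebra.
From mathcomp Require Export classical_sets.
From mathcomp Require Export mpoly.

Set Implicit Arguments.
Unset Strict Implicit.
Unset Printing Implicit Defensive.

Import GRing.Theory.
Local Open Scope ring_scope.
Local Open Scope classical_set_scope.

(* Finite sums of products [a * b] with [a] in [A] and [b] in [B].  This is the
   product of two modules inside [L], and also the submodule generated by [B]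
   when [A] is the ring of scalars, seen as a subset of [L]. *)
Definition sum_prod (L : pzRingType) (A B : set L) : set L :=
  [set x | exists (k : nat) (a b : 'I_k -> L),
    [/\ forall i, A (a i), forall i, B (b i) & x = \sum_(i < k) a i * b i]].

Definition sum_set (V : nmodType) (l : nat) (A : 'I_l -> set V) : set V :=
  [set x | exists2 u : 'I_l -> V, forall i, A i (u i) & x = \sum_(i < l) u i].

Section Dedekind.
Variable R : idomainType.

Definition is_ideal (I : set R) : Prop :=
  [/\ I 0, forall x y, I x -> I y -> I (x + y) & forall r x, I x -> I (r * x)].

Definition prime_ideal (P : set R) : Prop :=
  [/\ is_ideal P, ~ P 1 & forall x y, P (x * y) -> P x \/ P y].

Definition noetherian : Prop :=
  forall I : set R, is_ideal I -> exists s : seq R, I = sum_prod setT [set` s].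

Definition integrally_closed : Prop :=
  forall z : {fraction R}, integralOver (@tofrac R) z -> exists r : R, z = tofrac r.

Definition prime_chain (d : nat) (P : 'I_d.+1 -> set R) : Prop :=
  (forall i, prime_ideal (P i)) /\
  (forall i j : 'I_d.+1, (i < j)%N -> P i `<` P j).

Definition krull_dim (d : nat) : Prop :=
  (exists P : 'I_d.+1 -> set R, prime_chain P) /\
  ~ (exists P : 'I_d.+2 -> set R, prime_chain P).

Definition dedekind : Prop := [/\ noetherian, integrally_closed & krull_dim 1].

End Dedekind.

Record monomial_order (n : nat) (le : rel 'X_{1..n}) : Prop := MonomialOrder {
  mo_refl : reflexive le;
  mo_anti : antisymmetric le;
  mo_trans : transitive le;
  mo_total : total le;
  mo_add : forall m a b, le a b -> le (m + a)%MM (m + b)%MM;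
  mo_wf : well_founded (fun a b => (a != b) && le a b)
}.

(* Pairs (f, a) with no condition yet: see [is_pseudopoly]. *)
Definition ppair (R : idomainType) (n : nat) : Type :=
  ({mpoly {fraction R}[n]} * set {fraction R})%type.

Section PseudoPoly.
Variables (R : idomainType) (n : nat) (le : rel 'X_{1..n}).
Local Notation K := {fraction R}.

Definition imR : set K := range (@tofrac R).

Definition fractional_ideal (a : set K) : Prop :=
  (exists s : seq K, a = sum_prod imR [set` s]) /\ (exists2 x, a x & x != 0).

Definition ideal_inv (a : set K) : set K :=
  [set x | forall y, a y -> imR (x * y)].

Definition polys (a : set K) : set {mpoly K[n]} :=
  [set p | forall m, a p@_m].

(* For nonzero [f] the leading exponent for [le] ([mlead] is tied to one fixed
   ordering).  Junk value 0 when [f = 0]. *)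
Definition ldeg (f : {mpoly K[n]}) : 'X_{1..n} :=
  head 0%MM (sort (fun a b => le b a) (msupp f)).

Definition lc (f : {mpoly K[n]}) : K := f@_(ldeg f).

Definition lt (f : {mpoly K[n]}) : {mpoly K[n]} := lc f *: 'X_[ldeg f].

Definition is_pseudopoly (p : ppair R n) : Prop :=
  fractional_ideal p.2 /\ (forall c, p.2 c -> polys imR (c *: p.1)).

Definition nz_pseudopoly (p : ppair R n) : Prop :=
  is_pseudopoly p /\ p.1 != 0.

Definition pspan (p : ppair R n) : set {mpoly K[n]} :=
  [set h * p.1 | h in polys p.2].

Definition pLt (p : ppair R n) : set {mpoly K[n]} :=
  [set h * lt p.1 | h in polys p.2].

Definition Lt_ideal (I : set {mpoly K[n]}) : set {mpoly K[n]} :=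
  sum_prod (polys imR) [set lt f | f in [set f | I f /\ f != 0]].

Section Family.
Variables (l : nat) (G : 'I_l -> ppair R n).

Definition gspan : set {mpoly K[n]} := sum_set (fun i => pspan (G i)).

Definition gLt : set {mpoly K[n]} := sum_set (fun i => pLt (G i)).

Definition pseudo_groebner (I : set {mpoly K[n]}) : Prop :=
  [/\ forall i, nz_pseudopoly (G i), gspan `<=` I & Lt_ideal I = gLt].

Definition divides_lm (f : {mpoly K[n]}) (i : 'I_l) : bool :=
  (ldeg (G i).1 <= ldeg f)%MM.

Definition one_step (p q : ppair R n) : Prop :=
  p.1 != 0 /\
  exists a : 'I_l -> K,
  [/\ forall i, divides_lm p.1 i -> sum_prod (G i).2 (ideal_inv p.2) (a i),
      lc p.1 = \sum_(i | divides_lm p.1 i) a i * lc (G i).1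
    & q = (p.1 - \sum_(i | divides_lm p.1 i)
                   a i *: ('X_[(ldeg p.1 - ldeg (G i).1)%MM] * (G i).1),
           p.2)].

Definition reduces (p q : ppair R n) : Prop :=
  clos_refl_trans (ppair R n) one_step p q.

Definition reduces_to_0 (p : ppair R n) : Prop := reduces p (0, p.2).

End Family.

Definition spoly (p q : ppair R n) : ppair R n :=
  let m := mlcm (ldeg p.1) (ldeg q.1) in
  ((lc p.1)^-1 *: ('X_[(m - ldeg p.1)%MM] * p.1)
     - (lc q.1)^-1 *: ('X_[(m - ldeg q.1)%MM] * q.1),
   [set lc p.1 * c | c in p.2] `&` [set lc q.1 * c | c in q.2]).

End PseudoPoly.

(* Main.v *)
(* Nonzero ideals of a Dedekind domain are invertible; this is the only property
   of R that both implications use.  If G is a pseudo-Groebner basis and F f lies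
   in the span of G, then F lc(f) lies in the sum of the lc(g_i) G_i with lm(g_i)
   dividing lm(f); writing 1 as a sum of products of elements of F and F^-1 turns
   this into a one step reduction, and the remainder satisfies the same
   hypothesis.  Conversely (Buchberger), take a representation f = sum h_i g_i
   whose largest monomial lm(h_i g_i) is minimal.  If that monomial is not lm(f),
   its coefficients c_i in a_i = lc(g_i) G_i sum to 0.  With 1 = sum u_j and u_j in
   a_j (sum a_i)^-1, each u_j c_i lies in both a_i and a_j, and
   sum c_i v_i = sum u_j c_i (v_i - v_j) rewrites the leading part through
   S-polynomials, which have smaller representations because they reduce to 0. *)

From mathcomp Require Import boolp.
Require Import Defs.

Set Implicit Arguments.
Unset Strict Implicit.
Unset Printing Implicit Defensive.

Import GRing.Theory.
Local Open Scope ring_scope.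
Local Open Scope classical_set_scope.

(** * Closure properties of finite sums of products *)

Lemma sum_prod_sub (L : pzRingType) (A B C : set L) :
  C 0 -> (forall x y, C x -> C y -> C (x + y)) ->
  (forall a b, A a -> B b -> C (a * b)) -> sum_prod A B `<=` C.
Proof.
by move=> C0 CD CM _ [k [a [b [Aa Bb ->]]]]; apply: big_ind => // i _; exact: CM.
Qed.

Lemma sum_prod0 (L : pzRingType) (A B : set L) : sum_prod A B 0.
Proof. by exists 0, (fun=> 0), (fun=> 0); split=> [[]|[]|] //; rewrite big_ord0. Qed.

Lemma sum_prodM (L : pzRingType) (A B : set L) a b :
  A a -> B b -> sum_prod A B (a * b).
Proof. by move=> Aa Bb; exists 1, (fun=> a), (fun=> b); rewrite big_ord1. Qed.

Lemma sum_prodD (L : pzRingType) (A B : set L) x y :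
  sum_prod A B x -> sum_prod A B y -> sum_prod A B (x + y).
Proof.
move=> [k [a [b [Aa Bb ->]]]] [k' [a' [b' [Aa' Bb' ->]]]].
pose glue (f : 'I_k -> L) (f' : 'I_k' -> L) (i : 'I_(k + k')) :=
  match split i with inl j => f j | inr j => f' j end.
exists (k + k')%N, (glue a a'), (glue b b'); split.
- by move=> i; rewrite /glue; case: (split i).
- by move=> i; rewrite /glue; case: (split i).
rewrite big_split_ord /glue; congr (_ + _); apply: eq_bigr => i _.
  by rewrite (unsplitK (inl i)).
by rewrite (unsplitK (inr i)).
Qed.

(** * Invertibility of ideals in a Dedekind domain *)

Section Dedekind.
Variable R : idomainType.
Local Notation K := {fraction R}.

(** The ascending chain condition: without a maximal member, choice builds a strictly increasing
    chain [F] in [P]. Its union is an ideal whose finitely many generators already lie in some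
    [F N], so the chain cannot grow beyond [F N]. *)
Lemma noetherian_max (P : set (set R)) :
  noetherian R -> P `<=` @is_ideal R -> P !=set0 ->
  exists2 I, P I & forall J, P J -> I `<=` J -> J `<=` I.
Proof.
move=> noethR idP [I0 PI0]; apply: contrapT => noMax.
have grow I : exists J, P I -> [/\ P J, I `<=` J & ~ J `<=` I].
  have [PI|?] := pselect (P I); last by exists I.
  apply: contrapT => noJ; apply: noMax; exists I => // J PJ IJ.
  by apply: contrapT => nJI; apply: noJ; exists J.
have [next nextP] := boolp.choice grow.
pose F k := iter k next I0.
have PF k : P (F k) by elim: k => //= k /nextP[].
have subF j k : (j <= k)%N -> F j `<=` F k.
  elim: k => [|k IHk]; first by rewrite leqn0 => /eqP->.
  rewrite leq_eqVlt => /predU1P[-> //|/IHk sub].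
  by apply: subset_trans sub _; have [] := nextP _ (PF k).
have [s sE] : exists s : seq R, [set x | exists k, F k x] = sum_prod setT [set` s].
  apply: noethR; split.
  - by exists 0; have [] := idP _ PI0.
  - move=> x y [j Fx] [k Fy]; exists (maxn j k); have [_ FD _] := idP _ (PF (maxn j k)).
    by apply: FD; [apply: subF Fx; rewrite leq_maxl|apply: subF Fy; rewrite leq_maxr].
  - by move=> r x [k Fx]; exists k; have [_ _] := idP _ (PF k); apply.
have [N sN] : exists N, [set` s] `<=` F N.
  have: forall x, x \in s -> exists k, F k x.
    move=> x xs; suff: [set x | exists k, F k x] x by [].
    by rewrite sE -[x]mul1r; apply: sum_prodM.
  elim: s {sE} => [|x s IHs] sF; first by exists 0 => x.
  have [y ys|N sN] := IHs; first by apply: sF; rewrite inE ys orbT.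
  have [k Fk] := sF x (mem_head _ _); exists (maxn k N) => y /=.
  rewrite inE => /predU1P[->|ys]; first by apply: subF Fk; rewrite leq_maxl.
  by apply: subF (sN y ys); rewrite leq_maxr.
have [_ _] := nextP _ (PF N); apply=> x Fx.
have: [set x | exists k, F k x] x by exists N.+1.
rewrite sE; have [F0 FD FM] := idP _ (PF N).
by apply: sum_prod_sub => // a b _ /sN; exact: FM.
Qed.

(** An ideal maximal among those that contain [I] and avoid 1 is prime: for x outside it, 1 = m + r
    x, and multiplying by y shows that x y inside it forces y inside it. *)
Lemma prime_above (I : set R) : noetherian R -> is_ideal I -> ~ I 1 ->
  exists2 M, prime_ideal M & I `<=` M.
Proof.
move=> noethR idI I1.
have [||M [idM IM M1] maxM] :=
  @noetherian_max [set J | [/\ is_ideal J, I `<=` J & ~ J 1]] noethR.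
- by move=> J [].
- by exists I; split.
exists M => //; split=> // x y Mxy; apply: contrapT => /not_orP[Mx My].
have [M0 MD MM] := idM.
pose N := [set z | exists m r, M m /\ z = m + r * x].
have MN : M `<=` N by move=> m Mm; exists m, 0; rewrite mul0r addr0.
have idN : is_ideal N.
  split; first exact: MN.
  - move=> _ _ [m [r [Mm ->]]] [m' [r' [Mm' ->]]]; exists (m + m'), (r + r').
    by split; [exact: MD | rewrite mulrDl addrACA].
  - move=> r _ [m [r' [Mm ->]]]; exists (r * m), (r * r').
    by split; [exact: MM | rewrite mulrDr mulrA].
have [[m [r [Mm one]]]|N1] := pselect (N 1).
  apply: My; rewrite -[y]mul1r one mulrDl -mulrA.
  by apply: MD; [rewrite mulrC|]; exact: MM.
apply: Mx; apply: (maxM N); [split=> //; exact: subset_trans MN | by [] |].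
by exists 0, 1; rewrite mul1r add0r.
Qed.

(** The annihilator of the class of [c] in R/(a). *)
Definition colon (a c : R) : set R := [set r | exists t, r * c = t * a].

Lemma colon_ideal a c : is_ideal (colon a c).
Proof.
split.
- by exists 0; rewrite !mul0r.
- by move=> x y [t xt] [u yu]; exists (t + u); rewrite !mulrDl xt yu.
- by move=> r x [t xt]; exists (r * t); rewrite -!mulrA xt.
Qed.

(* A colon ideal (a) : c that is maximal among those contained in M is prime:
   it is the trace of an associated prime of R_M/(a). *)
Lemma associated_prime_below (M : set R) a : noetherian R -> prime_ideal M -> M a ->
  exists2 c, prime_ideal (colon a c) & colon a c `<=` M.
Proof.
move=> noethR [[M0 MD MM] M1 Mprime] Ma.
have [||_ [[c ->] cM] maxP] :=
  @noetherian_max [set J | (exists c, J = colon a c) /\ J `<=` M] noethR.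
- by move=> _ [[c ->] _]; exact: colon_ideal.
- exists (colon a 1); split; first by exists 1.
  by move=> r [t]; rewrite mulr1 => ->; exact: MM.
exists c => //; split; [exact: colon_ideal | by move/cM|].
move=> x y [t xyt]; apply: contrapT => /not_orP[Px Py].
(* Passing from [c] to a multiple can only enlarge the colon ideal, so by maximality it stays the
   same as long as it remains inside [M]. *)
have maxc u : colon a (u * c) `<=` M -> colon a (u * c) `<=` colon a c.
  move=> uM; apply: maxP; first by split=> //; exists (u * c).
  by move=> r [v rv]; exists (u * v); rewrite mulrCA rv mulrA.
(* If (a) : x c stays inside [M], maximality applies to it, and it contains y. Otherwise it contains
   some z outside [M]; primality of [M] keeps (a) : z c inside [M], and that ideal contains x. *)
have [xM|] := pselect (colon a (x * c) `<=` M).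
  by apply: Py; apply: maxc xM _ _; exists t; rewrite -xyt mulrCA mulrA.
apply: contra_notP => _ z [u zu]; apply: contrapT => Mz; apply: Px.
apply: (maxc z); last by exists u; rewrite -zu mulrCA.
move=> w [v wv]; have: M (w * z) by apply: cM; exists v; rewrite -mulrA.
by case/Mprime.
Qed.

(** Otherwise 0, [P], [M] would be a strict chain of three primes; [a] makes the first inclusion
    strict. *)
Lemma krull_dim1_maximal (P M : set R) a : krull_dim R 1 ->
  prime_ideal P -> prime_ideal M -> P `<=` M -> P a -> a != 0 -> M `<=` P.
Proof.
move=> [_ noChain] primeP primeM PM Pa a0; apply: contrapT => nMP; apply: noChain.
(* The default value [M] of [nth] is the third prime of the chain. *)
exists (fun i : 'I_3 => nth M [:: [set 0]; P] i); split.
  case=> [[|[|[|//]]]] //= _; split=> [||x y /eqP].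
  - by split=> [//|x y -> ->|r x ->]; rewrite ?addr0 ?mulr0.
  - by move/eqP; rewrite oner_eq0.
  - by rewrite mulf_eq0 => /orP[] /eqP; [left|right].
have P0 : [set 0] `<=` P by move=> _ ->; have [[]] := primeP.
have nP0 : ~ P `<=` [set 0] by move/(_ a Pa)/eqP; rewrite (negPf a0).
case=> [[|[|[|//]]]] //= _ [[|[|[|//]]]] //= _ _.
- by split; [apply: subset_trans PM | move/(subset_trans PM)].
Qed.

(** The witness is c/a with (a) : c prime. Dimension one makes this prime contain a prime [M] above
    [J], so c J lies in (a); and c/a in R would put 1 in (a) : c. *)
Lemma dedekind_dual (J : set R) a : dedekind R -> is_ideal J -> ~ J 1 ->
  J a -> a != 0 -> exists2 x : K, ~ imR x & forall r, J r -> imR (x * tofrac r).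
Proof.
move=> [noethR _ dim1] idJ J1 Ja a0.
have [M primeM JM] := prime_above noethR idJ J1.
have [c primeP PM] := associated_prime_below noethR primeM (JM _ Ja).
have MP : M `<=` colon a c.
  apply: (krull_dim1_maximal dim1 primeP primeM PM _ a0).
  by exists c; rewrite mulrC.
have fa0 : tofrac a != 0 by rewrite tofrac_eq0.
exists (tofrac c / tofrac a).
  case=> t _ tE; case: primeP => _ P1 _; apply: P1; exists t; apply/eqP.
  by rewrite mul1r -tofrac_eq tofracM tE divfK.
move=> r /JM/MP[t rt]; exists t => //.
by rewrite mulrAC -tofracM [c * r]mulrC rt tofracM mulfK.
Qed.

(** Collects one coefficient per generator, so that multiplication by an element can be described by
    a square matrix. *)
Lemma sum_prod_seqP (s : seq R) y : sum_prod setT [set` s] y ->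
  exists c : 'I_(size s) -> R, y = \sum_i c i * s`_i.
Proof.
move: y; apply: sum_prod_sub.
- by exists (fun=> 0); rewrite big1 // => i _; rewrite mul0r.
- move=> x y [c ->] [d ->]; exists (fun i => c i + d i).
  by rewrite -big_split; apply: eq_bigr => i _; rewrite mulrDl.
- move=> a b _ /= bs; have ltb : (index b s < size s)%N by rewrite index_mem.
  exists (fun i => if i == Ordinal ltb then a else 0).
  rewrite (bigD1 (Ordinal ltb)) //= eqxx nth_index // big1 ?addr0 // => i /negPf->.
  by rewrite mul0r.
Qed.

(** The determinant trick: multiplication by [x] acts on generators of [A] through a matrix over R,
    the generators form a nonzero eigenvector for [x], and the characteristic polynomial is
    monic. *)
Lemma ideal_stable_integral (A : set R) a (x : K) : noetherian R -> is_ideal A ->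
  A a -> a != 0 ->
  (forall r, A r -> exists2 r', A r' & x * tofrac r = tofrac r') ->
  integralOver (@tofrac R) x.
Proof.
move=> noethR idA Aa a0 xA; have [s sE] := noethR A idA.
have As i : (i < size s)%N -> A s`_i.
  by move=> lti; rewrite sE -[_`_i]mul1r; apply: sum_prodM => //=; rewrite mem_nth.
have row (j : 'I_(size s)) : exists c : 'I_(size s) -> R,
    x * tofrac s`_j = \sum_i tofrac (c i) * tofrac s`_i.
  have [r Ar ->] := xA _ (As j (ltn_ord j)); move: Ar; rewrite sE => /sum_prod_seqP[c ->].
  by exists c; rewrite rmorph_sum; apply: eq_bigr => i _; rewrite rmorphM.
have [c cE] := boolp.choice row.
(* Transposed, because [eigenvalueP] multiplies row vectors by the matrix on the right. *)
pose g : 'M[R]_(size s) := \matrix_(i, j) c j i.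
exists (char_poly g); first exact: char_poly_monic.
rewrite map_char_poly -eigenvalue_root_char; apply/eigenvalueP.
exists (\row_i tofrac s`_i).
  apply/rowP=> j; rewrite !mxE cE; apply: eq_bigr => i _.
  by rewrite !mxE mulrC.
apply: contra_neq a0 => s0; move: Aa; rewrite sE => /sum_prod_seqP[d ->].
rewrite big1 // => i _; have /rowP/(_ i) := s0; rewrite !mxE => /eqP.
by rewrite tofrac_eq0 => /eqP->; rewrite mulr0.
Qed.

Definition submodule (A : set K) : Prop :=
  [/\ A 0, forall x y, A x -> A y -> A (x + y) & forall r x, imR r -> A x -> A (r * x)].

Lemma imR_submodule : submodule (@imR R).
Proof.
split; first by exists 0; rewrite ?tofrac0.
- by move=> _ _ [x _ <-] [y _ <-]; exists (x + y); rewrite ?tofracD.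
- by move=> _ _ [x _ <-] [y _ <-]; exists (x * y); rewrite ?tofracM.
Qed.

Lemma submodule_sum (A : set K) (I : Type) (r : seq I) (P : pred I) (F : I -> K) :
  submodule A -> (forall i, P i -> A (F i)) -> A (\sum_(i <- r | P i) F i).
Proof. by move=> [A0 AD _] AF; apply: big_ind. Qed.

(* If J = A A^-1 were proper, some x outside R would satisfy x J <= R, hence
   x A^-1 <= A^-1; then x stabilizes the ideal b A^-1 of R for 0 != b in A, so x
   is integral over R. *)
Lemma dedekind_invertible (A : set K) b : dedekind R -> submodule A ->
  A `<=` @imR R -> A b -> b != 0 -> sum_prod A (ideal_inv A) 1.
Proof.
move=> dedR [A0 AD AM] AR Ab b0; have [noethR closedR _] := dedR.
have [imR0 imRD imRM] := imR_submodule.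
have invD y z : ideal_inv A y -> ideal_inv A z -> ideal_inv A (y + z).
  by move=> Iy Iz w Aw; rewrite mulrDl; apply: imRD; [exact: Iy|exact: Iz].
have invM r y : imR r -> ideal_inv A y -> ideal_inv A (r * y).
  by move=> Rr Iy w Aw; rewrite -mulrA; apply: imRM => //; exact: Iy.
have inv0 : ideal_inv A 0 by move=> w _; rewrite mul0r.
(* With 1 in the inverse of [A], the nonzero element b = [tofrac c] lies both in the product [J] and
   in the ideal [B] below, as [dedekind_dual] and [ideal_stable_integral] require. *)
have inv1 : ideal_inv A 1 by move=> w /AR; rewrite mul1r.
have [c _ cb] := AR _ Ab; have c0 : c != 0 by rewrite -tofrac_eq0 cb.
pose J := [set r | sum_prod A (ideal_inv A) (tofrac r)].
apply: contrapT => nJ1.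
have nJ1' : ~ J 1 by rewrite /J /= tofrac1.
have idJ : is_ideal J.
  split; rewrite /J /=; first by rewrite tofrac0; exact: sum_prod0.
  - by move=> x y Jx Jy; rewrite tofracD; exact: sum_prodD.
  - move=> r x Jx; rewrite tofracM mulrC.
    move: (tofrac x) Jx; apply: sum_prod_sub; first by rewrite mul0r; exact: sum_prod0.
      by move=> y z Jy Jz; rewrite mulrDl; exact: sum_prodD.
    move=> y z Ay Iz; rewrite -mulrA; apply: sum_prodM => //; rewrite mulrC.
    by apply: invM => //; exists r.
have [|x nRx xJ] := dedekind_dual dedR idJ nJ1' _ c0.
  by rewrite /J /= cb -[b]mulr1; exact: sum_prodM.
have xinv y : ideal_inv A y -> ideal_inv A (x * y).
  move=> Iy z Az; have [r _ rE] := Iy z Az; rewrite -mulrA -rE; apply: xJ.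
  by rewrite /J /= rE mulrC; exact: sum_prodM.
pose B := [set r | exists2 y, ideal_inv A y & tofrac r = b * y].
apply: nRx; have [|r ->] := closedR x; last by exists r.
apply: (@ideal_stable_integral B c) => //.
- split.
  + by exists 0; rewrite ?mulr0 ?tofrac0.
  + move=> r r' [y Iy ry] [z Iz rz]; exists (y + z); first exact: invD.
    by rewrite tofracD ry rz mulrDr.
  + move=> r r' [y Iy ry]; exists (tofrac r * y); last by rewrite tofracM ry mulrCA.
    by apply: invM => //; exists r.
- by exists 1; rewrite ?mulr1.
- move=> r [y Iy ry]; have [r' _ r'E] := xinv y Iy b Ab.
  exists r'; last by rewrite ry r'E mulrCA mulrC.
  by exists (x * y); [exact: xinv | rewrite r'E mulrC].
Qed.

End Dedekind.

(** * Submodules of the fraction field *)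

Section Ideals.
Variable R : idomainType.
Local Notation K := {fraction R}.

Lemma fractional_submodule (A : set K) : fractional_ideal A -> submodule A.
Proof.
have [imR0 imRD imRM] := imR_submodule R.
case=> -[s ->] _; split; [exact: sum_prod0 | by move=> x y; exact: sum_prodD |].
move=> r x Rr; move: x; apply: sum_prod_sub.
- by rewrite mulr0; exact: sum_prod0.
- by move=> x y; rewrite mulrDr; exact: sum_prodD.
- by move=> a b Ra sb; rewrite mulrA; apply: sum_prodM => //; exact: imRM.
Qed.

Lemma submoduleI (A B : set K) : submodule A -> submodule B -> submodule (A `&` B).
Proof.
move=> [A0 AD AM] [B0 BD BM]; split=> // [x y [? ?] [? ?]|r x Rr [? ?]].
  by split; [exact: AD | exact: BD].
by split; [exact: AM | exact: BM].
Qed.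

Lemma submodule_scale c (A : set K) : submodule A -> submodule [set c * x | x in A].
Proof.
move=> [A0 AD AM]; split; first by exists 0; rewrite ?mulr0.
- by move=> _ _ [x Ax <-] [y Ay <-]; exists (x + y); [exact: AD | rewrite mulrDr].
- by move=> r _ Rr [x Ax <-]; exists (r * x); [exact: AM | rewrite mulrCA].
Qed.

(** Turns the coefficients of a one step reduction, which involve the inverse of an ideal, into
    coefficients allowed in the span of the family. *)
Lemma mul_quotient_mem (A B : set K) a c : submodule A ->
  sum_prod A (ideal_inv B) a -> B c -> A (c * a).
Proof.
move=> [A0 AD AM] Aa Bc; move: a Aa; apply: sum_prod_sub; rewrite ?mulr0 //.
- by move=> x y; rewrite mulrDr; exact: AD.
- by move=> x y Ax By; rewrite mulrCA mulrC; apply: AM => //; rewrite mulrC; exact: By.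
Qed.

(* With d the sum of the A i, write 1 as a sum of u i, where u i is in (A i) d^-1. *)
Lemma dedekind_partition_of_unity l (A : 'I_l -> set K) (J : pred 'I_l) i0 :
  dedekind R -> (forall i, submodule (A i)) -> (forall i, A i `<=` @imR R) ->
  J i0 -> (exists2 x, A i0 x & x != 0) ->
  exists2 u : 'I_l -> K, \sum_(i | J i) u i = 1 &
    forall i j c, J i -> J j -> A i c -> A i (u j * c) /\ A j (u j * c).
Proof.
move=> dedR smA AR Ji0 [b Ab b0].
pose D := [set x | exists2 e : 'I_l -> K, forall i, A i (e i) & x = \sum_(i | J i) e i].
have AD i : J i -> A i `<=` D.
  move=> Ji x Ax; exists (fun j => if j == i then x else 0).
    by move=> j; case: eqP => [->//|_]; have [] := smA j.
  by rewrite (bigD1 i) //= eqxx big1 ?addr0 // => j /andP[_ /negPf->].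
have smD : submodule D.
  split.
  - exists (fun=> 0); last by rewrite big1.
    by move=> i; have [] := smA i.
  - move=> _ _ [e Ae ->] [f Af ->]; exists (fun i => e i + f i); last by rewrite big_split.
    by move=> i; have [_ + _] := smA i; apply.
  - move=> r _ Rr [e Ae ->]; exists (fun i => r * e i); last by rewrite mulr_sumr.
    by move=> i; have [_ _] := smA i; apply.
have DR : D `<=` @imR R.
  move=> _ [e Ae ->]; apply: submodule_sum; first exact: imR_submodule.
  by move=> i _; apply: (AR i).
have [k [a [v [Da Iv one]]]] := dedekind_invertible dedR smD DR (AD _ Ji0 _ Ab) b0.
have /boolp.choice[e eP] : forall j : 'I_k, exists e : 'I_l -> K,
    (forall i, A i (e i)) /\ a j = \sum_(i | J i) e i.
  by move=> j; have [e ? ?] := Da j; exists e.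
exists (fun i => \sum_j e j i * v j).
  rewrite exchange_big one; apply: eq_bigr => j _.
  by have [_ ->] := eP j; rewrite mulr_suml.
move=> i j c Ji Jj Ac; rewrite mulr_suml.
have eA t : A j (e t j) by have [+ _] := eP t; apply.
(* Both [A i] and [A j] lie in [D], so [v t] carries [e t j] and [c] into R: the first makes [u j] a
   scalar acting on [A i], the second leaves a multiple of [e t j] in [A j]. *)
split; apply: submodule_sum => // t _.
  have [_ _] := smA i; apply=> //; rewrite mulrC; apply: Iv.
  exact: AD (eA t).
have [_ _ AM] := smA j; rewrite -mulrA mulrC; apply: AM => //; apply: Iv.
exact: AD Ac.
Qed.

End Ideals.

(** * Representations and S-polynomials *)

Section MonomialOrder.
Variables (n : nat) (le : rel 'X_{1..n}).
Hypothesis mo : monomial_order le.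

Local Notation slt := (fun a b : 'X_{1..n} => (a != b) && le a b).

(** Stated for any list, since it serves both supports of polynomials and the list of products in
    [rep_bound]. *)
Lemma head_sortP (s : seq 'X_{1..n}) (d := head 0%MM (sort (fun a b => le b a) s)) :
  s != [::] -> d \in s /\ {in s, forall m, le m d}.
Proof.
move=> s0; pose ge a b := le b a.
have ge_total : total ge by move=> a b; apply: (mo_total mo).
have ge_trans : transitive ge by move=> a b c ab bc; exact: (mo_trans mo bc ab).
have := sort_sorted ge_total s; have memE := mem_sort ge s.
rewrite {}/d -/ge; case: (sort ge s) memE => [|d t] memE /=.
  by case: s s0 memE => // x s _ /(_ x); rewrite mem_head.
rewrite (path_sortedE ge_trans) => /andP[/allP dt _].
split=> [|m]; rewrite -memE inE ?eqxx // => /predU1P[->|/dt//].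
exact: (mo_refl mo).
Qed.

Lemma slt_le_trans b a c : slt a b -> le b c -> slt a c.
Proof.
move=> /andP[ab le_ab] le_bc; rewrite (mo_trans mo le_ab le_bc) andbT.
apply: contra_neq ab => ac; apply: (mo_anti mo); rewrite le_ab ac.
by rewrite le_bc.
Qed.

Lemma slt_add m a b : slt a b -> slt (m + a)%MM (m + b)%MM.
Proof.
move=> /andP[ab le_ab]; rewrite (mo_add mo) // andbT.
by apply: contra_neq ab; exact: addmI.
Qed.

(** Treats weak bounds, strict bounds and the absence of a bound on exponents uniformly. *)
Definition down_closed (P : 'X_{1..n} -> Prop) := forall a b, le a b -> P b -> P a.

Lemma down_closed_le d : down_closed (fun m => le m d).
Proof. by move=> a b ab; exact: (mo_trans mo). Qed.

Lemma down_closed_slt d : down_closed (fun m => slt m d).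
Proof.
move=> a b le_ab bd; case: (eqVneq a b) => [->//|ab].
by apply: (@slt_le_trans b); [rewrite ab | case/andP: bd].
Qed.

(** * Leading terms and multiplication by monomials *)

Section Polynomials.
Variable R : idomainType.
Local Notation K := {fraction R}.
Implicit Types f g : {mpoly K[n]}.

Lemma ldeg_supp f : f != 0 -> ldeg le f \in msupp f.
Proof. by rewrite -msupp_eq0 => /head_sortP[]. Qed.

Lemma le_ldeg f m : m \in msupp f -> le m (ldeg le f).
Proof.
move=> fm; have /head_sortP[_] : msupp f != [::] by apply: contraTneq fm => ->.
exact.
Qed.

Lemma lc_neq0 f : f != 0 -> lc le f != 0.
Proof. by rewrite -mcoeff_msupp; exact: ldeg_supp. Qed.

Lemma ldeg_eq f d : d \in msupp f -> {in msupp f, forall m, le m d} -> ldeg le f = d.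
Proof.
move=> fd maxd; apply: (mo_anti mo); rewrite le_ldeg // andbT; apply: maxd.
by apply: ldeg_supp; apply: contraTneq fd => ->; rewrite msupp0.
Qed.

Lemma mcoeffXM d f m :
  ('X_[d] * f)@_m = if (d <= m)%MM then f@_(m - d)%MM else 0.
Proof.
rewrite mulrC; case: ifP => [dm|/negP dm].
  by rewrite -{1}(submK dm) addmC mcoeffMX.
apply: memN_msupp_eq0; apply/negP=> /msuppM_le/allpairsP[[a b]] /= [_].
by rewrite msuppX inE => /eqP-> mE; apply: dm; rewrite mE lem_addl.
Qed.

Lemma mem_msuppXM d f m : m \in msupp ('X_[d] * f) ->
  exists2 k, k \in msupp f & m = (d + k)%MM.
Proof.
rewrite mcoeff_msupp mcoeffXM; case: ifP => [dm fm|_]; last by rewrite eqxx.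
by exists (m - d)%MM; rewrite ?mcoeff_msupp // addmC submK.
Qed.

Lemma ldegXM_le d f m : m \in msupp ('X_[d] * f) -> le m (d + ldeg le f)%MM.
Proof. by move=> /mem_msuppXM[k fk ->]; apply: (mo_add mo); exact: le_ldeg. Qed.

Lemma lcXM d f : ('X_[d] * f)@_(d + ldeg le f) = lc le f.
Proof. by rewrite mcoeffXM lem_addr addmC addmK. Qed.

Lemma lc_shift e f : (ldeg le f <= e)%MM ->
  ('X_[(e - ldeg le f)%MM] * f)@_e = lc le f.
Proof. by move=> fe; rewrite mcoeffXM lem_subr submBA // addmC addmK. Qed.

Lemma ltZXM c d f : c != 0 -> f != 0 ->
  lt le (c *: ('X_[d] * f)) = c *: ('X_[d] * lt le f).
Proof.
move=> c0 f0; have ldE : ldeg le (c *: ('X_[d] * f)) = (d + ldeg le f)%MM.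
  apply: ldeg_eq => [|m /msuppZ_le]; last exact: ldegXM_le.
  by rewrite mcoeff_msupp mcoeffZ lcXM mulf_neq0 // lc_neq0.
by rewrite /lt {1}/lc ldE mcoeffZ lcXM -scalerAr scalerA mpolyXD.
Qed.

End Polynomials.

(** * Representations over the family and their behaviour under reduction *)

Section Family.
Variables (R : idomainType) (l : nat) (G : 'I_l -> ppair R n).
Local Notation K := {fraction R}.
Local Notation g i := (G i).1.
Local Notation d i := (ldeg le (G i).1).
Hypothesis smG : forall i, submodule (G i).2.
Implicit Types (f : {mpoly K[n]}) (P Q : 'X_{1..n} -> Prop).

(* A representation of f in terms of G whose partial products h i * g i only
   involve leading monomials satisfying P. *)
Definition rep P f := exists2 h : 'I_l -> {mpoly K[n]},
  forall i m, (G i).2 (h i)@_m /\ (m \in msupp (h i) -> P (m + d i)%MM) &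
  f = \sum_i h i * g i.

Lemma rep0 P : rep P 0.
Proof.
exists (fun=> 0) => [i m|]; last by rewrite big1 // => i _; rewrite mul0r.
by rewrite mcoeff0 msupp0; split=> //; have [] := smG i.
Qed.

Lemma repD P f f' : rep P f -> rep P f' -> rep P (f + f').
Proof.
move=> [h hP ->] [h' hP' ->]; exists (fun i => h i + h' i).
  move=> i m; have [Gh Ph] := hP i m; have [Gh' Ph'] := hP' i m; split.
    by rewrite mcoeffD; have [_ + _] := smG i; apply.
  by move/msuppD_le; rewrite mem_cat => /orP[/Ph|/Ph'].
by rewrite -big_split; apply: eq_bigr => i _; rewrite mulrDl.
Qed.

Lemma repN P f : rep P f -> rep P (- f).
Proof.
move=> [h hP ->]; exists (fun i => - h i).
  move=> i m; have [Gh Ph] := hP i m; split; last by rewrite (perm_mem (msuppN _)).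
  rewrite mcoeffN -mulN1r; have [_ _] := smG i; apply=> //.
  by exists (-1); rewrite ?tofracN ?tofrac1.
by rewrite -sumrN; apply: eq_bigr => i _; rewrite mulNr.
Qed.

Lemma rep_sum P (I : Type) (r : seq I) (Q : pred I) (F : I -> {mpoly K[n]}) :
  (forall i, Q i -> rep P (F i)) -> rep P (\sum_(i <- r | Q i) F i).
Proof. by move=> PF; apply: big_ind => //; [exact: rep0 | exact: repD]. Qed.

Lemma rep_term P i c m : (G i).2 c -> P (m + d i)%MM -> rep P (c *: ('X_[m] * g i)).
Proof.
move=> Gc Pm; exists (fun j => if j == i then c *: 'X_[m] else 0).
  move=> j k; case: eqP => [->|_]; last first.
    by rewrite mcoeff0 msupp0; split=> //; have [] := smG j.
  split; last by move/msuppZ_le; rewrite msuppX inE => /eqP->.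
  rewrite mcoeffZ mcoeffX; case: eqP => _; rewrite ?mulr1 // mulr0.
  by have [] := smG i.
rewrite (bigD1 i) //= eqxx scalerAl big1 ?addr0 // => j /negPf->.
by rewrite mul0r.
Qed.

Lemma repXM P Q k f : (forall m, P m -> Q (k + m)%MM) -> rep P f -> rep Q ('X_[k] * f).
Proof.
move=> PQ [h hP ->]; exists (fun i => 'X_[k] * h i).
  move=> i m; split; last first.
    by move=> /mem_msuppXM[j hj ->]; rewrite -addmA; apply: PQ; have [_] := hP i j; apply.
  rewrite mcoeffXM; case: ifP => _; first by have [] := hP i (m - k)%MM.
  by have [] := smG i.
by rewrite mulr_sumr; apply: eq_bigr => i _; rewrite mulrA.
Qed.

Lemma gspanE : gspan G = rep (fun=> True).
Proof.
apply/seteqP; split=> f.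
  move=> [u uP ->]; apply: rep_sum => i _; have [h hP <-] := uP i.
  rewrite [h]mpolyE mulr_suml; apply: rep_sum => m _.
  by rewrite -scalerAl; apply: rep_term => //; exact: hP.
move=> [h hP ->]; exists (fun i => h i * g i) => // i; exists (h i) => // m.
by have [] := hP i m.
Qed.

Lemma rep_supp P f m : down_closed P -> rep P f -> m \in msupp f -> P m.
Proof.
move=> dP [h hP ->] /msupp_sum_le/flattenP[_ /mapP[i _ ->]].
move=> /msuppM_le/allpairsP[[a b] /= [ha gb ->]].
have [_ /(_ ha)] := hP i a; apply: dP; apply: (mo_add mo); exact: le_ldeg.
Qed.

(** The largest of the finitely many exponents [m + d i] that occur is attained, hence inherits [P].
    With [P] a strict bound this supplies the descent in Buchberger's argument. *)
Lemma rep_bound P f : rep P f -> f != 0 -> exists2 e, P e & rep (fun m => le m e) f.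
Proof.
move=> [h hP fE] f0.
pose s := [seq (m + d i)%MM | i <- enum 'I_l, m <- msupp (h i)].
have hs i m : m \in msupp (h i) -> (m + d i)%MM \in s.
  by move=> hm; apply/allpairsPdep; exists i, m; rewrite mem_enum.
have /head_sortP[] : s != [::].
  apply: contra_neq f0 => s0; rewrite fE big1 // => i _.
  suff -> : h i = 0 by rewrite mul0r.
  apply/eqP; rewrite -msupp_eq0; case E : (msupp (h i)) => [//|m t].
  by have := hs i m; rewrite s0 E mem_head => /(_ isT).
move: (head _ _) => e es maxe; exists e.
  by have /allpairsPdep[i [m [_ hm ->]]] := es; have [_] := hP i m; apply.
exists h => // i m; have [Gh _] := hP i m; split=> // hm.
exact/maxe/hs.
Qed.

(** In each [h i] only the term that brings the leading monomial of [g i] exactly to [e] is split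
    off; every other product stays strictly below [e]. *)
Lemma rep_split e f : rep (fun m => le m e) f ->
  exists2 t : 'I_l -> K, forall i, (G i).2 (t i) &
    rep (fun m => slt m e)
      (f - \sum_(i | (d i <= e)%MM) t i *: ('X_[(e - d i)%MM] * g i)).
Proof.
(* Where [d i] does not divide [e], the truncated [e - d i] picks an irrelevant coefficient; it
   still lies in the ideal of [G i], and the sum skips that index. *)
move=> [h hP ->]; exists (fun i => (h i)@_(e - d i)%MM) => [i|].
  by have [] := hP i (e - d i)%MM.
rewrite [X in _ - X]big_mkcond -sumrB; apply: rep_sum => i _.
have -> : h i * g i - (if (d i <= e)%MM then
      (h i)@_(e - d i)%MM *: ('X_[(e - d i)%MM] * g i) else 0) =
    \sum_(m <- msupp (h i) | (m + d i)%MM != e) (h i)@_m *: ('X_[m] * g i).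
  have -> : h i * g i = \sum_(m <- msupp (h i)) (h i)@_m *: ('X_[m] * g i).
    by rewrite {1}[h i]mpolyE mulr_suml; apply: eq_bigr => m _; rewrite -scalerAl.
  case: ifP => die; last first.
    rewrite subr0 [RHS]big_mkcond; apply: eq_bigr => m _; case: eqP => // eE.
    by rewrite -eE lem_addl in die.
  have [hm|hm] := boolP ((e - d i)%MM \in msupp (h i)); last first.
    rewrite (memN_msupp_eq0 hm) scale0r subr0 [RHS]big_mkcond !big_seq.
    apply: eq_bigr => m; case: eqP => // eE.
    by rewrite -eE addmK in hm; rewrite (negPf hm).
  rewrite (bigD1_seq (e - d i)%MM) ?msupp_uniq //= addrAC subrr add0r.
  apply: eq_bigl => m; congr negb; apply/eqP/eqP => [->|<-]; first exact: submK.
  by rewrite addmK.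
rewrite big_seq_cond; apply: rep_sum => m /andP[hm me].
have [Gh /(_ hm) mle] := hP i m.
by apply: rep_term => //; rewrite me.
Qed.

(** The subtracted products all have the leading monomial of [p.1], so bounds on the support
    persist; scaling by [c] in [p.2] moves their coefficients into the ideals of the family. *)
Lemma one_step_rep p q : one_step le G p q ->
  [/\ q.2 = p.2,
      forall P, down_closed P -> {in msupp p.1, forall m, P m} ->
        {in msupp q.1, forall m, P m}
    & forall P c, down_closed P -> {in msupp p.1, forall m, P m} -> p.2 c ->
        exists2 f, rep P f & c *: q.1 = c *: p.1 - f].
Proof.
case: p => f A /= [f0 [a [aP lcE ->]]] /=.
have dvd i : divides_lm le G f i -> ((ldeg le f - d i) + d i)%MM = ldeg le f.
  exact: submK.
split=> // P.
  move=> dP fP m /msuppB_le; rewrite mem_cat => /orP[/fP //|].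
  move=> /msupp_sum_le/flattenP[s /mapP[i]]; rewrite mem_filter => /andP[Ji _] ->.
  move=> /msuppZ_le/ldegXM_le; rewrite dvd // => mle.
  by apply: dP mle _; apply: fP; exact: ldeg_supp.
move=> c dP fP Ac.
exists (\sum_(i | divides_lm le G f i)
  (c * a i) *: ('X_[(ldeg le f - d i)%MM] * g i)).
  apply: rep_sum => i Ji; apply: rep_term.
    exact: mul_quotient_mem (smG i) (aP i Ji) Ac.
  by rewrite dvd //; apply: fP; exact: ldeg_supp.
rewrite scalerBr scaler_sumr; congr (_ - _).
by apply: eq_bigr => i _; rewrite scalerA.
Qed.

Lemma reduces_rep p q : reduces le G p q ->
  [/\ q.2 = p.2,
      forall P, down_closed P -> {in msupp p.1, forall m, P m} ->
        {in msupp q.1, forall m, P m}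
    & forall P c, down_closed P -> {in msupp p.1, forall m, P m} -> p.2 c ->
        exists2 f, rep P f & c *: q.1 = c *: p.1 - f].
Proof.
elim=> {p q} [p q|p|p q r _ [qp pqP pqR] _ [rq qrP qrR]]; first exact: one_step_rep.
  by split=> // P c _ _ _; exists 0; [exact: rep0 | rewrite subr0].
split; first by rewrite rq.
  by move=> P dP pP; apply: qrP => //; exact: pqP.
move=> P c dP pP pc; have [f Pf fE] := pqR P c dP pP pc.
have [|f' Pf' f'E] := qrR P c dP (pqP P dP pP); first by rewrite qp.
by exists (f + f'); [exact: repD | rewrite f'E fE opprD addrA].
Qed.

(** The subtracted parts of the whole chain add up to [c *: p.1], which gives a standard
    representation when [P] is the bound by the leading exponent. *)
Lemma reduces_to_0_rep p P c : reduces_to_0 le G p -> down_closed P ->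
  {in msupp p.1, forall m, P m} -> p.2 c -> rep P (c *: p.1).
Proof.
move=> /reduces_rep[_ _ pR] dP pP pc; have [f Pf] := pR P c dP pP pc.
by rewrite scaler0 => /esym/eqP; rewrite subr_eq0 => /eqP->.
Qed.

(** * The module generated by the leading terms of the family *)

Lemma polys_mul (A : set K) (h k : {mpoly K[n]}) : submodule A ->
  polys (@imR R) h -> polys A k -> polys A (h * k).
Proof.
move=> smA Rh Ak m; rewrite mcoeffM; apply: submodule_sum => // j _.
by have [_ _] := smA; apply.
Qed.

Lemma gLt_mul h k : polys (@imR R) h -> gLt le G k -> gLt le G (h * k).
Proof.
move=> Rh [u uP ->]; exists (fun i => h * u i); last by rewrite mulr_sumr.
move=> i; have [w wP <-] := uP i; exists (h * w); last by rewrite mulrA.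
exact: polys_mul.
Qed.

Lemma gLt0 : gLt le G 0.
Proof.
exists (fun=> 0); last by rewrite big1.
by move=> i; exists 0; [move=> m; rewrite mcoeff0; have [] := smG i | rewrite mul0r].
Qed.

Lemma gLtD k k' : gLt le G k -> gLt le G k' -> gLt le G (k + k').
Proof.
move=> [u uP ->] [v vP ->]; exists (fun i => u i + v i); last by rewrite big_split.
move=> i; have [h hP <-] := uP i; have [h' hP' <-] := vP i.
exists (h + h'); last by rewrite mulrDl.
by move=> m; rewrite mcoeffD; have [_ + _] := smG i; apply.
Qed.

(** The generators are terms, so membership can be read off at a single exponent; this is where the
    condition for a one step reduction comes from. *)
Lemma gLt_coeff k e : gLt le G k ->
  exists2 t : 'I_l -> K, forall i, (G i).2 (t i) &
    k@_e = \sum_(i | (d i <= e)%MM) t i * lc le (g i).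
Proof.
move=> [u uP ->].
have /boolp.choice[h hP] : forall i, exists h, polys (G i).2 h /\ h * lt le (g i) = u i.
  by move=> i; have [h ? ?] := uP i; exists h.
exists (fun i => (h i)@_(e - d i)%MM) => [i|]; first by have [] := hP i.
rewrite raddf_sum [RHS]big_mkcond; apply: eq_bigr => i _; have [_ <-] := hP i.
rewrite /lt -scalerAr [h i * _]mulrC /= mcoeffZ mcoeffXM mulrC.
by case: ifP => // _; rewrite mul0r.
Qed.

Hypothesis nzG : forall i, g i != 0.

(** Converse of [gLt_coeff] for a single term: shifting by [e - d i] brings each leading term with
    [d i] dividing [e] to exponent [e]. *)
Lemma gLt_term e (t : 'I_l -> K) : (forall i, (G i).2 (t i)) ->
  gLt le G ((\sum_(i | (d i <= e)%MM) t i * lc le (g i)) *: 'X_[e]).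
Proof.
move=> Gt; exists (fun i => if (d i <= e)%MM then (t i * lc le (g i)) *: 'X_[e] else 0).
  move=> i; case: ifP => [die|_]; last first.
    by exists 0; [move=> m; rewrite mcoeff0; have [] := smG i | rewrite mul0r].
  exists (t i *: 'X_[(e - d i)%MM]); last first.
    by rewrite /lt -scalerAl -scalerAr scalerA -mpolyXD submK.
  move=> m; rewrite mcoeffZ mcoeffX; case: eqP => _; rewrite ?mulr1 // mulr0.
  by have [] := smG i.
by rewrite scaler_suml big_mkcond.
Qed.

(** Expand each multiplier into terms: a term times the leading term of [g i] is the leading term of
    that term times [g i], an element of the span. *)
Lemma gLt_Lt_ideal : gLt le G `<=` Lt_ideal le (gspan G).
Proof.
move=> _ [u uP ->].
have LD := @sum_prodD _ (polys (@imR R))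
  [set lt le f | f in [set f | gspan G f /\ f != 0]].
apply: big_ind; [exact: sum_prod0 | exact: LD |].
move=> i _; have [h hP <-] := uP i.
rewrite [h]mpolyE mulr_suml big_seq.
apply: big_ind; [exact: sum_prod0 | exact: LD | move=> m hm].
have hm0 : h@_m != 0 by rewrite -mcoeff_msupp.
rewrite -[_ * _]mul1r; apply: sum_prodM.
  move=> k; rewrite mcoeff1; exists ((k == 0%MM)%:R) => //.
  by case: (k == 0%MM); rewrite ?tofrac1 ?tofrac0.
exists (h@_m *: ('X_[m] * g i)); last by rewrite ltZXM // scalerAl.
split; first by rewrite gspanE; exact: rep_term.
rewrite -msupp_eq0; apply/eqP => s0.
have : (m + d i)%MM \in msupp (h@_m *: ('X_[m] * g i)).
  by rewrite mcoeff_msupp mcoeffZ lcXM mulf_neq0 // lc_neq0.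
by rewrite s0.
Qed.

(** * S-polynomials and leading coefficient ideals *)

Local Notation a i := [set lc le (g i) * c | c in (G i).2].

(** Going from the lcm to another common multiple [e] costs one monomial factor shared by both
    terms, so the differences in the syzygy argument are multiples of S-polynomials. *)
Lemma spoly_scale i j e : (d i <= e)%MM -> (d j <= e)%MM ->
  (lc le (g i))^-1 *: ('X_[(e - d i)%MM] * g i) -
  (lc le (g j))^-1 *: ('X_[(e - d j)%MM] * g j) =
  'X_[(e - mlcm (d i) (d j))%MM] * (spoly le (G i) (G j)).1.
Proof.
move=> die dje.
have le_e : (mlcm (d i) (d j) <= e)%MM by rewrite lem_mlcm die.
have shift m : (m <= mlcm (d i) (d j))%MM ->
    (e - m = (e - mlcm (d i) (d j)) + (mlcm (d i) (d j) - m))%MM.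
  by move=> mle; rewrite addmBA // submK.
by rewrite /= mulrBr -!scalerAr !mulrA -!mpolyXD -!shift ?lem_mlcml ?lem_mlcmr.
Qed.

(** Both shifted polynomials have coefficient 1 at the lcm, their largest exponent, and these
    cancel. *)
Lemma spoly_supp i j m : m \in msupp (spoly le (G i) (G j)).1 ->
  slt m (mlcm (d i) (d j)).
Proof.
set e := mlcm _ _ => sm.
have die : (e - d i + d i)%MM = e by rewrite submK // lem_mlcml.
have dje : (e - d j + d j)%MM = e by rewrite submK // lem_mlcmr.
apply/andP; split.
  apply: contraTneq sm => ->; rewrite mcoeff_msupp negbK /= -/e mcoeffB !mcoeffZ.
  rewrite !lc_shift ?lem_mlcml ?lem_mlcmr //.
  by rewrite !mulVf ?lc_neq0 // subrr.
move: sm => /msuppB_le; rewrite mem_cat => /orP[] /msuppZ_le/ldegXM_le.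
  by rewrite -/e die.
by rewrite -/e dje.
Qed.

Hypothesis dedR : dedekind R.
Hypothesis integralG : forall i, a i `<=` @imR R.
Hypothesis a_neq0 : forall i, exists2 x, a i x & x != 0.

(** An intersection of two nonzero ideals of R is nonzero: it contains the product of nonzero
    elements [x] and [y] taken from each. *)
Lemma spoly_invertible i j (A := (spoly le (G i) (G j)).2) :
  sum_prod A (ideal_inv A) 1.
Proof.
have [[x ax x0] [y ay y0]] := (a_neq0 i, a_neq0 j).
have smA k : submodule (a k) by exact: submodule_scale.
apply: (@dedekind_invertible R _ (x * y) dedR).
- exact: submoduleI.
- by move=> c [/integralG].
- split; last by have [_ _] := smA j; apply=> //; exact: integralG ax.
  by rewrite mulrC; have [_ _] := smA i; apply=> //; exact: integralG ay.
- exact: mulf_neq0.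
Qed.

(** An element of the intersection is divisible by both leading coefficients, with quotients in the
    respective ideals. *)
Lemma spoly_gspan i j c : (spoly le (G i) (G j)).2 c ->
  gspan G (c *: (spoly le (G i) (G j)).1).
Proof.
rewrite gspanE => -[[x Gx xE] [y Gy yE]].
rewrite /= scalerBr -scaleNr !scalerA; apply: repD; apply: rep_term => //.
  by rewrite -xE mulrAC mulfV ?mul1r ?lc_neq0.
rewrite -yE mulNr mulrAC mulfV ?mul1r ?lc_neq0 //.
have [_ _ GM] := smG j; rewrite -mulN1r; apply: GM => //; exists (-1) => //.
by rewrite tofracN tofrac1.
Qed.

(* The partition of unity u turns the syzygy (t i) of the leading terms into the
   combination of the S-polynomials with coefficients u j * t i. *)
Lemma syzygy_rep e (t : 'I_l -> K) :
  (forall i j : 'I_l, (i < j)%N -> reduces_to_0 le G (spoly le (G i) (G j))) ->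
  (forall i, (G i).2 (t i)) ->
  \sum_(i | (d i <= e)%MM) t i * lc le (g i) = 0 ->
  rep (fun m => slt m e) (\sum_(i | (d i <= e)%MM) t i *: ('X_[(e - d i)%MM] * g i)).
Proof.
move=> red Gt sum0.
(* The hypothesis covers only i < j; exchanging the indices changes the sign of the S-polynomial,
   and equal indices give 0. *)
have repS i j c : a i c -> a j c ->
    rep (fun m => slt m (mlcm (d i) (d j))) (c *: (spoly le (G i) (G j)).1).
  have lt_case (i' j' : 'I_l) c' : (i' < j')%N -> a i' c' -> a j' c' ->
      rep (fun m => slt m (mlcm (d i') (d j'))) (c' *: (spoly le (G i') (G j')).1).
    move=> ltij ai aj; apply: reduces_to_0_rep => //; first exact: red.
      exact: down_closed_slt.
    by move=> m; exact: spoly_supp.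
  have smA k : submodule (a k) by exact: submodule_scale.
  have [ltij|ltji|/val_inj->] := ltngtP i j; first exact: lt_case.
    move=> ai aj; have -> : c *: (spoly le (G i) (G j)).1 = - c *: (spoly le (G j) (G i)).1.
      by rewrite /= mlcmC scaleNr -scalerN opprB.
    rewrite mlcmC -mulN1r; have m1 : @imR R (-1) by exists (-1); rewrite ?tofracN ?tofrac1.
    by apply: lt_case => //; [have [_ _] := smA j | have [_ _] := smA i]; apply.
  by move=> _ _; rewrite /= subrr scaler0; exact: rep0.
have [i0 Ji0|J0] := pickP (fun i => (d i <= e)%MM); last first.
  by rewrite big_pred0 //; exact: rep0.
have [u u1 uP] := @dedekind_partition_of_unity _ _ _ (fun i => (d i <= e)%MM) _ dedR
  (fun i => submodule_scale (lc le (g i)) (smG i)) integralG Ji0 (a_neq0 i0).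
pose v i := (lc le (g i))^-1 *: ('X_[(e - d i)%MM] * g i).
pose c i := t i * lc le (g i).
have ac i : a i (c i) by exists (t i); rewrite // mulrC.
have -> : \sum_(i | (d i <= e)%MM) t i *: ('X_[(e - d i)%MM] * g i) =
    \sum_(i | (d i <= e)%MM) \sum_(j | (d j <= e)%MM) (u j * c i) *: (v i - v j).
  (* The first double sum collapses because the [u j] add up to 1, the second vanishes because the
     [c i] add up to 0. *)
  transitivity (\sum_(i | (d i <= e)%MM) \sum_(j | (d j <= e)%MM) (u j * c i) *: v i -
      \sum_(i | (d i <= e)%MM) \sum_(j | (d j <= e)%MM) (u j * c i) *: v j).
    rewrite [X in _ - X]exchange_big /= [X in _ - X]big1 ?subr0 => [|j _]; last first.
      by rewrite -scaler_suml -mulr_sumr sum0 mulr0 scale0r.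
    apply: eq_bigr => i _; rewrite -scaler_suml -mulr_suml u1 mul1r /v /c scalerA.
    by rewrite mulfK ?lc_neq0.
  rewrite -sumrB; apply: eq_bigr => i _; rewrite -sumrB.
  by apply: eq_bigr => j _; rewrite scalerBr.
apply: rep_sum => i Ji; apply: rep_sum => j Jj.
have [au_i au_j] := uP i j (c i) Ji Jj (ac i).
rewrite /v spoly_scale // scalerAr; apply: repXM (repS _ _ _ au_i au_j) => m.
by move/(slt_add (e - mlcm (d i) (d j))%MM); rewrite submK // lem_mlcm Ji.
Qed.

(** Minimality of the representation becomes well-founded induction on its bound [e]. If [f] has a
    nonzero coefficient at [e], then [e] is its leading exponent; otherwise [syzygy_rep] lowers the
    bound. *)
Lemma buchberger_lt f :
  (forall i j : 'I_l, (i < j)%N -> reduces_to_0 le G (spoly le (G i) (G j))) ->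
  gspan G f -> f != 0 -> gLt le G (lt le f).
Proof.
move=> red; rewrite gspanE => repf0 f0; have [e _ repe] := rep_bound repf0 f0.
elim/(well_founded_ind (mo_wf mo)): e repe {repf0} => e IHe repe.
have [t Gt rept] := rep_split repe.
have fe : f@_e = \sum_(i | (d i <= e)%MM) t i * lc le (g i).
  have /eqP : (f - \sum_(i | (d i <= e)%MM) t i *: ('X_[(e - d i)%MM] * g i))@_e = 0.
    apply: memN_msupp_eq0; apply/negP=> /(rep_supp (@down_closed_slt e) rept).
    by rewrite eqxx.
  rewrite mcoeffB subr_eq0 => /eqP->; rewrite raddf_sum; apply: eq_bigr => i die.
  by rewrite /= mcoeffZ lc_shift.
have [fe0|fe0] := eqVneq f@_e 0; last first.
  rewrite /lt /lc (_ : ldeg le f = e) ?fe; first exact: gLt_term.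
  apply: ldeg_eq; first by rewrite mcoeff_msupp.
  by move=> m; apply: rep_supp repe; exact: down_closed_le.
have repf : rep (fun m => slt m e) f.
  rewrite -[f](subrK (\sum_(i | (d i <= e)%MM) t i *: ('X_[(e - d i)%MM] * g i))).
  by apply: repD => //; apply: syzygy_rep => //; rewrite -fe.
by have [e' lte' repe'] := rep_bound repf f0; exact: IHe lte' repe'.
Qed.

(** * Reduction to zero modulo a pseudo-Gröbner basis *)

Lemma groebner_one_step (f : {mpoly K[n]}) (A : set K) :
  Lt_ideal le (gspan G) = gLt le G ->
  sum_prod A (ideal_inv A) 1 -> (forall c, A c -> gspan G (c *: f)) -> f != 0 ->
  exists f', [/\ one_step le G (f, A) (f', A),
    forall c, A c -> gspan G (c *: f') & {in msupp f', forall m, slt m (ldeg le f)}].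
Proof.
move=> groeb [k [x [y [Ax Iy one]]]] spanf f0.
have lift c : A c -> exists t : 'I_l -> K, (forall i, (G i).2 (t i)) /\
    c * lc le f = \sum_(i | divides_lm le G f i) t i * lc le (g i).
  (* [Lt_ideal] takes leading terms of nonzero elements only, so c = 0 is treated apart. *)
  move=> Ac; have [->|c0] := eqVneq c 0.
    exists (fun=> 0); split; first by move=> i; have [] := smG i.
    by rewrite mul0r big1 // => i _; rewrite mul0r.
  have : gLt le G (lt le (c *: f)).
    rewrite -groeb -[lt _ _]mul1r; apply: sum_prodM.
      move=> m; rewrite mcoeff1; exists ((m == 0%MM)%:R) => //.
      by case: (m == 0%MM); rewrite ?tofrac1 ?tofrac0.
    exists (c *: f) => //; split; first exact: spanf.
    by rewrite scaler_eq0 negb_or c0.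
  have -> : c *: f = c *: ('X_[0%MM] * f) by rewrite mpolyX0 mul1r.
  rewrite ltZXM // mpolyX0 mul1r => /(gLt_coeff (ldeg le f))[t Gt tE].
  by exists t; split=> //; rewrite -tE mcoeffZ /lt mcoeffZ mcoeffX eqxx mulr1.
have /boolp.choice[t tP] : forall j : 'I_k, exists t : 'I_l -> K,
    (forall i, (G i).2 (t i)) /\
    x j * lc le f = \sum_(i | divides_lm le G f i) t i * lc le (g i).
  by move=> j; exact: lift.
(* Weighting the lifts of [x j * lc le f] by [y j] recovers the leading coefficient itself, since
   the [x j * y j] add up to 1. *)
pose b i := \sum_j t j i * y j.
have bP i : sum_prod (G i).2 (ideal_inv A) (b i).
  exists k, (t^~ i), y; split=> // j; by have [+ _] := tP j; apply.
pose f' := f - \sum_(i | divides_lm le G f i) b i *: ('X_[(ldeg le f - d i)%MM] * g i).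
have lcE : lc le f = \sum_(i | divides_lm le G f i) b i * lc le (g i).
  transitivity (\sum_j \sum_(i | divides_lm le G f i) t j i * y j * lc le (g i)).
    rewrite -[LHS]mul1r one mulr_suml; apply: eq_bigr => j _.
    rewrite mulrAC; have [_ ->] := tP j; rewrite mulr_suml.
    by apply: eq_bigr => i _; rewrite mulrAC.
  by rewrite exchange_big; apply: eq_bigr => i _; rewrite mulr_suml.
have step : one_step le G (f, A) (f', A) by split=> //; exists b.
have dT : down_closed (fun=> True) by [].
exists f'; split=> // [c Ac|m f'm].
  have [_ _ stepR] := one_step_rep step.
  have [//|//|h reph /= ->] := stepR _ c dT.
  rewrite gspanE; apply: repD; first by rewrite -gspanE; exact: spanf.
  exact: repN.
apply/andP; split; last first.
  have [_ stepP _] := one_step_rep step.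
  apply: (stepP _ (@down_closed_le (ldeg le f))) f'm => m'; exact: le_ldeg.
apply: contraTneq f'm => ->; rewrite mcoeff_msupp negbK mcoeffB -[f@_ _]/(lc le f) lcE.
rewrite raddf_sum -sumrB big1 // => i Ji.
by rewrite /= mcoeffZ lc_shift ?subrr.
Qed.

Lemma groebner_reduces_to_0 (f : {mpoly K[n]}) (A : set K) :
  Lt_ideal le (gspan G) = gLt le G ->
  sum_prod A (ideal_inv A) 1 -> (forall c, A c -> gspan G (c *: f)) ->
  reduces_to_0 le G (f, A).
Proof.
move=> groeb invA; move eE: (ldeg le f) => e.
elim/(well_founded_ind (mo_wf mo)): e f eE => e IHe f eE spanf.
have [->|f0] := eqVneq f 0; first exact: rt_refl.
have [f' [step spanf' lt_f']] := groebner_one_step groeb invA spanf f0.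
apply: (@rt_trans _ _ _ (f', A)); first exact: rt_step.
(* For [f'] zero, [ldeg] is only a default value that need not have decreased, so induction is used
   for nonzero [f'] alone. *)
have [->|f'0] := eqVneq f' 0; first exact: rt_refl.
by apply: IHe (erefl _) spanf'; rewrite -eE; apply: lt_f'; exact: ldeg_supp.
Qed.

End Family.
End MonomialOrder.

Theorem corollary4p7 (R : idomainType) (n : nat) (le : rel 'X_{1..n}) (l : nat)
    (G : 'I_l -> ppair R n) :
  dedekind R ->
  monomial_order le ->
  (forall i, nz_pseudopoly (G i)) ->
  pseudo_groebner le G (gspan G) <->
  (forall i j : 'I_l, (i < j)%N -> reduces_to_0 le G (spoly le (G i) (G j))).
Proof.
move=> dedR mo ppG.
have nzG i : (G i).1 != 0 by have [] := ppG i.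
have smG i : submodule (G i).2.
  by have [[fracG _] _] := ppG i; exact: fractional_submodule.
(* The pseudo-polynomial condition, read at the leading exponent. *)
have integralG i : [set lc le (G i).1 * c | c in (G i).2] `<=` @imR R.
  move=> _ [c Gc <-]; have [[_ polyG] _] := ppG i.
  by rewrite mulrC -mcoeffZ; exact: polyG.
have a_neq0 i : exists2 x, [set lc le (G i).1 * c | c in (G i).2] x & x != 0.
  have [[[_ [x Gx x0]] _] _] := ppG i.
  by exists (lc le (G i).1 * x); [exists x | rewrite mulf_neq0 // lc_neq0].
split=> [[_ _ groeb] i j _ | red].
  have := spoly_invertible smG dedR integralG a_neq0 i j.
  have := @spoly_gspan _ _ mo _ _ G smG nzG i j.
  by case: (spoly _ _ _) => f A spanf invA; exact: groebner_reduces_to_0.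
split=> //; apply/seteqP; split; last exact: (gLt_Lt_ideal mo smG nzG).
apply: sum_prod_sub.
- exact: (gLt0 le smG).
- by move=> x y; exact: (gLtD smG).
- move=> h _ Rh [f [spanf f0] <-]; apply: (gLt_mul smG) => //.
  exact: (buchberger_lt mo smG nzG dedR integralG a_neq0 red).
Qed.
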